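(* Let $\vec J_o\in\mathbb R^L$ be a link incentive with associated equilibrium flow $\vec f_o=h(\vec J_o)$, and let $\phi(\vec J,\vec f)=g(C(\vec f)+\vec J)-\vec f$. If $\phi(\vec J,\cdot)$ is locally one-to-one in a neighborhood of $(\vec J_o,\vec f_o)$ (or if $\phi$ is differentiable and $\nabla_{\vec f}\,\phi(\vec J_o,\vec f_o)$ is invertible), then $h$ is a continuous map in a neighborhood of $\vec J_o$.
   Context: There are $L$ links and $M$ routes (hyperpaths). $B=(b_{lm})\in[0,1]^{L\times M}$ is the link-route matrix, with $b_{lm}$ the probability that route $m$ traverses link $l$. The link cost function is $C:\mathbb R^L\to\mathbb R^L$, mapping link flow vectors to link cost vectors. The route utility function is $V(\vec c)=-b\,B^{T}\vec c-\vec c_s$ with constants $b\ge0$, $\vec c_s\in\mathbb R^M$. With $\epsilon_1,\dots,\epsilon_M$ independent random variables with a common density (unobserved utilities; Gumbel in the logit case), the route choice function is $P(\vec v)=(p_1(\vec v),\dots,p_M(\vec v))^T$, $p_m(\vec v)=\mathrm{Prob}(v_m+\epsilon_m>v_j+\epsilon_j\ \forall j\neq m)$, and the satisfaction function is $S(\vec v)=\mathbb E[\max_m(v_m+\epsilon_m)]$. The elastic demand function is $D:\mathbb R\to[0,\hat d_{\max}]$, with $\hat d_{\max}>0$ constant. The set of feasible link flows is $\mathcal F=\{B\vec x:\vec x\in\mathbb R^M,\ \vec x\ge0,\ \sum_m x_m\in[0,\hat d_{\max}]\}$. The traffic assignment function is $g:\mathbb R^L\to\mathcal F$, $g(\vec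 c)=B\,P(V(\vec c))\,D(S(V(\vec c)))$. The map $\phi$ is regarded as a map $\mathbb R^L\times\mathbb R^L\to\mathbb R^L$. Standing assumptions: $C,P,S,D$ are continuous, and for every link incentive vector $\vec J\in\mathbb R^L$ the map $\vec f\mapsto g(C(\vec f)+\vec J)$ from $\mathcal F$ to itself has a unique fixed point, the equilibrium flow under $\vec J$, denoted $h(\vec J)$. ''$\phi(\vec J,\cdot)$ is locally one-to-one in a neighborhood of $(\vec J_o,\vec f_o)$'' means: there are neighborhoods $U$ of $\vec J_o$ and $W$ of $\vec f_o$ such that for each $\vec J\in U$ the map $\vec f\mapsto\phi(\vec J,\vec f)$ is injective on $W$. *)

(* Defs.v *)
From HB Require Import structures.
From mathcomp Require Import all_boot all_order all_algebra.
From mathcomp Require Import all_classical all_reals all_analysis.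

Set Implicit Arguments.
Unset Strict Implicit.
Unset Printing Implicit Defensive.

Import Order.TTheory GRing.Theory Num.Theory.
Import numFieldNormedType.Exports.

Local Open Scope classical_set_scope.
Local Open Scope ring_scope.

Section Probability.
Context (d : measure_display) (Om : measurableType d) (R : realType).
Context (Pr : probability Om R) (M : nat).

Definition independent_RVs (eps : 'I_M -> {RV Pr >-> R}) : Prop :=
  forall (I : {set 'I_M}) (A : 'I_M -> set R),
    (forall m, measurable (A m)) ->
    Pr (\bigcap_(m in [set m | m \in I]) (eps m @^-1` A m)) =
    (\prod_(m in I) Pr (eps m @^-1` A m))%E.

Definition has_density (X : {RV Pr >-> R}) (rho : R -> R) : Prop :=
  [/\ measurable_fun setT rho, forall x, 0 <= rho x &
      forall A : set R, measurable A ->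
        distribution Pr X A = (\int[lebesgue_measure]_(x in A) (rho x)%:E)%E].

Definition route_choice (eps : 'I_M -> {RV Pr >-> R}) (v : 'cV[R]_M) :
    'cV[R]_M :=
  \col_m fine (Pr [set w | forall j : 'I_M, j != m ->
                     v j 0 + eps j w < v m 0 + eps m w]).

(* The maximum is taken in \bar R so that -oo can serve as neutral element; it
   is a real number as soon as 0 < M, and it is not integrable when M = 0. *)
Definition max_perceived_utility (eps : 'I_M -> {RV Pr >-> R}) (v : 'cV[R]_M)
    (w : Om) : \bar R :=
  \big[maxe/-oo%E]_(m < M) (v m 0 + eps m w)%:E.

(* Only meaningful if max_perceived_utility eps v is integrable: fine sends an
   infinite expectation to 0. *)
Definition satisfaction (eps : 'I_M -> {RV Pr >-> R}) (v : 'cV[R]_M) : R :=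
  fine (\int[Pr]_w max_perceived_utility eps v w)%E.

End Probability.

Section Traffic.
Context (R : realType) (L M : nat).

Definition route_utility (B : 'M[R]_(L, M)) (b : R) (cs : 'cV[R]_M)
    (c : 'cV[R]_L) : 'cV[R]_M :=
  - (b *: (B^T *m c)) - cs.

Definition feasible_flows (B : 'M[R]_(L, M)) (dmax : R) : set 'cV[R]_L :=
  [set B *m x | x in [set x : 'cV[R]_M |
     (forall m, 0 <= x m 0) /\ 0 <= \sum_m x m 0 <= dmax]].

Definition traffic_assignment (B : 'M[R]_(L, M)) (V : 'cV[R]_L -> 'cV[R]_M)
    (P : 'cV[R]_M -> 'cV[R]_M) (S : 'cV[R]_M -> R) (D : R -> R)
    (c : 'cV[R]_L) : 'cV[R]_L :=
  D (S (V c)) *: (B *m P (V c)).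

Definition equilibrium_flow (F : set 'cV[R]_L) (g C : 'cV[R]_L -> 'cV[R]_L)
    (J f : 'cV[R]_L) : Prop :=
  F f /\ g (C f + J) = f.

Definition excess_flow (g C : 'cV[R]_L -> 'cV[R]_L)
    (x : 'cV[R]_L * 'cV[R]_L) : 'cV[R]_L :=
  g (C x.2 + x.1) - x.2.

Definition locally_one_to_one (phi : 'cV[R]_L * 'cV[R]_L -> 'cV[R]_L)
    (Jo fo : 'cV[R]_L) : Prop :=
  exists U W : set 'cV[R]_L, [/\ nbhs Jo U, nbhs fo W &
    forall J, U J -> {in W &, injective (fun f => phi (J, f))}].

(* Matrix of partial derivatives, rows indexed by the components of psi (the
   library's jacobian is for row vectors and has the transposed layout). *)
Definition gradient_mx (psi : 'cV[R]_L -> 'cV[R]_L) (f : 'cV[R]_L) : 'M[R]_L :=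
  \matrix_(i, j) 'D_(delta_mx j 0) (fun x => psi x i 0) f.

End Traffic.

(* Main.v *)
Require Import Defs.
From HB Require Import structures.
From mathcomp Require Import all_boot all_order all_algebra.
From mathcomp Require Import all_classical all_reals all_analysis.

Import Order.TTheory GRing.Theory Num.Theory.
Import numFieldNormedType.Exports.

Local Open Scope classical_set_scope.
Local Open Scope ring_scope.

(* Feasible flows form a compact set, on which the equilibrium is the unique
   zero of the jointly continuous excess flow.  A unique zero in a compact set
   depends continuously on the parameter: at flows x other than h(t), the excess
   stays nonzero near (t, x), and finitely many such neighbourhoods cover the
   compact set outside a given neighbourhood of h(t). *)

Lemma unique_zero_continuous (T X Y : topologicalType) (K : set X) (y : Y)
    (phi : T * X -> Y) (h : T -> X) :
  accessible_space Y -> compact K -> continuous phi ->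
  (forall t, K (h t)) ->
  (forall t x, K x -> phi (t, x) = y <-> x = h t) ->
  continuous h.
Proof.
move=> Yacc /compact_near_coveringP Kcov phic hK hE t N Nht.
(* The near-covering form of compactness turns a property that holds near each [x] in [K] and near
   [t] into one that holds on all of [K] for [t'] near [t]. The disjunction handles both kinds of
   points: near [h t] the set [N] itself serves, with no constraint on [t']. *)
have cover : forall x, K x ->
    \forall x' \near x & t' \near t, N x' \/ phi (t', x') <> y.
  move=> x Kx; have [xE|xNE] := pselect (x = h t).
    exists (N, setT); first by split; [rewrite xE|exact: filterT].
    by move=> -[x' t'] [/= Nx' _]; left.
  have op : open (~` [set y]) by apply/closed_openC/accessible_closed_set1.
  (* Joint continuity yields a product neighbourhood of [(t, x)] on which [phi] avoids [y]. *)
  have /phic : nbhs (phi (t, x)) (~` [set y]).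
    by apply: open_nbhs_nbhs; split=> // /(hE _ _ Kx).
  case=> -[U W] /= [Ut Wx] UW; exists (W, U) => //= -[x' t'] [/= Wx' Ut'].
  by right; apply: (UW (t', x')).
suff : \forall t' \near t, N (h t') by [].
(* Evaluated at [x' = h t'], the second alternative fails because [h t'] is a zero, so [h t'] lies
   in [N]. *)
apply: filterS (Kcov _ _ (fun t' x' => N x' \/ phi (t', x') <> y)
  (nbhs_filter t) cover) => t' /(_ _ (hK t')) [//|].
by case; apply/(hE _ _ (hK t')).
Qed.

Section MatrixContinuity.
Context {R : realType}.

Lemma mx_coord_continuous {T : topologicalType} (m n : nat)
    (f : T -> 'M[R]_(m, n)) :
  (forall i j, continuous (fun t => f t i j)) -> continuous f.
Proof.
move=> fc t A [P fP] sPA; apply: (@filterS _ _ _ _ _ sPA).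
(* Indexing the entries by pairs makes this a single finite intersection of neighbourhoods. *)
have : \forall t' \near t, forall k : 'I_m * 'I_n, P k.1 k.2 (f t' k.1 k.2).
  by apply: filter_forall => -[i j]; apply: fc; apply: fP.
by apply: filterS => t' Pt' i j; exact: (Pt' (i, j)).
Qed.

(** Serves both for the entries of a matrix product and, with all coefficients 1, for the total of a
    route flow. *)
Lemma sum_entry_continuous (I : Type) (r : seq I) (a : I -> R) (m n : nat)
    (i : I -> 'I_m) (j : I -> 'I_n) :
  continuous (fun x : 'M[R]_(m, n) => \sum_(k <- r) a k * x (i k) (j k)).
Proof.
apply: continuous_big => [|k _ x]; first exact: add_continuous.
by apply: continuousM; [exact: cst_continuous|exact: coord_continuous].
Qed.

Lemma mulmx_continuous (m n p : nat) (A : 'M[R]_(m, n)) :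
  continuous (fun x : 'M[R]_(n, p) => A *m x).
Proof.
apply: mx_coord_continuous => i j.
under eq_fun do rewrite mxE.
exact: sum_entry_continuous.
Qed.

Lemma trmx_continuous (m n : nat) : continuous (@trmx R m n).
Proof.
apply: mx_coord_continuous => i j.
under eq_fun do rewrite mxE.
exact: coord_continuous.
Qed.

End MatrixContinuity.

(** The feasible route flows form a closed subset of the cube with side [[0, dmax]], and the link
    flows are their image under a linear map. *)
Lemma feasible_flows_compact (R : realType) (L M : nat) (B : 'M[R]_(L, M))
    (dmax : R) :
  compact (feasible_flows B dmax).
Proof.
apply: continuous_compact.
  exact/continuous_subspaceT/mulmx_continuous.
(* Transposing lets [rV_compact], stated for row vectors, give compactness of a cube of columns. *)
pose cube := trmx @` [set x : 'rV[R]_M | forall m, `[0, dmax]%classic (x 0 m)].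
apply: (@subclosed_compact _ _ cube).
(* The lower bound on the total follows from nonnegative coordinates; the factor 1 matches
   [sum_entry_continuous]. *)
- have -> : [set x : 'cV[R]_M |
      (forall m, 0 <= x m 0) /\ 0 <= \sum_m x m 0 <= dmax] =
    (\bigcap_m ((fun x : 'cV[R]_M => x m 0) @^-1` [set y | 0 <= y])) `&`
    ((fun x : 'cV[R]_M => \sum_m 1 * x m 0) @^-1` [set y | y <= dmax]).
    apply/seteqP; split=> x /=.
      case=> x0 /andP[_ xd]; split=> [m _|]; first exact: x0.
      by under eq_bigr do rewrite mul1r.
    case=> x0 xd; split=> [m|]; first exact: x0.
    rewrite sumr_ge0 => [|m _]; last exact: x0.
    by under eq_bigr do rewrite -[x _ _]mul1r.
  apply: closedI.
    apply: closed_bigI => m _; apply: preimage_closed; last exact: closed_ge.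
    by move=> x _; exact: coord_continuous.
  apply: preimage_closed; last exact: closed_le.
  by move=> x _; exact: sum_entry_continuous.
- apply: continuous_compact; first exact/continuous_subspaceT/trmx_continuous.
  apply: (@rV_compact _ _ (fun=> `[0, dmax]%classic)) => m.
  exact: segment_compact.
- move=> x [x0 /andP[_ xd]]; exists x^T; last by rewrite trmxK.
  move=> m; rewrite /= mxE in_itv /= x0 (le_trans _ xd)//.
  (* A coordinate is at most the total, since the other coordinates are nonnegative. *)
  by rewrite (bigD1 m)//= lerDl sumr_ge0.
Qed.

Lemma excess_flow_continuous (R : realType) (L M : nat) (B : 'M[R]_(L, M))
    (b : R) (cs : 'cV[R]_M) (P : 'cV[R]_M -> 'cV[R]_M) (S : 'cV[R]_M -> R)
    (D : R -> R) (C : 'cV[R]_L -> 'cV[R]_L) :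
  continuous C -> continuous P -> continuous S -> continuous D ->
  continuous
    (excess_flow (traffic_assignment B (route_utility B b cs) P S D) C).
Proof.
move=> Cc Pc Sc Dc.
have Vc : continuous (route_utility B b cs).
  move=> c; apply: (@cvgB _ _ _ _ (nbhs_filter c)); last exact: cst_continuous.
  apply: (@cvgN _ _ _ _ (nbhs_filter c)).
  apply: (@cvgZ _ _ _ _ (nbhs_filter c)); first exact: cst_continuous.
  exact: mulmx_continuous.
have gc : continuous (traffic_assignment B (route_utility B b cs) P S D).
  move=> c; apply: (@cvgZ _ _ _ _ (nbhs_filter c)).
    exact: (continuous_comp (continuous_comp (Vc c) (Sc _)) (Dc _)).
  exact: (continuous_comp (continuous_comp (Vc c) (Pc _))
    (mulmx_continuous _ _ _ B _)).
move=> x; apply: (@cvgB _ _ _ _ (nbhs_filter x)); last exact: cvg_snd.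
suff xc : {for x, continuous (fun x : 'cV[R]_L * 'cV[R]_L => C x.2 + x.1)}.
  exact: (continuous_comp xc (gc _)).
apply: (@cvgD _ _ _ _ (nbhs_filter x)); last exact: cvg_fst.
by apply: continuous_comp (Cc _); exact: cvg_snd.
Qed.

Theorem proposition1 (R : realType) (L M : nat)
    (B : 'M[R]_(L, M)) (hB : forall l m, 0 <= B l m <= 1)
    (C : 'cV[R]_L -> 'cV[R]_L)
    (b : R) (hb : 0 <= b) (cs : 'cV[R]_M)
    (d : measure_display) (Om : measurableType d) (Pr : probability Om R)
    (eps : 'I_M -> {RV Pr >-> R}) (rho : R -> R)
    (heps_indep : independent_RVs eps)
    (heps_density : forall m, has_density (eps m) rho)
    (hmax : forall v : 'cV[R]_M,
       Pr.-integrable setT (max_perceived_utility eps v))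
    (dmax : R) (hdmax : 0 < dmax)
    (D : R -> R) (hD : forall s, 0 <= D s <= dmax) :
  let V := route_utility B b cs in
  let P := route_choice eps in
  let S := satisfaction eps in
  let F := feasible_flows B dmax in
  let g := traffic_assignment B V P S D in
  let phi := excess_flow g C in
  continuous C -> continuous P -> continuous S -> continuous D ->
  (forall J, exists! f, equilibrium_flow F g C J f) ->
  forall h : 'cV[R]_L -> 'cV[R]_L,
  (forall J, equilibrium_flow F g C J (h J)) ->
  forall Jo fo : 'cV[R]_L, fo = h Jo ->
  (locally_one_to_one phi Jo fo \/
   ((forall x, differentiable phi x) /\
    gradient_mx (fun f => phi (Jo, f)) fo \in unitmx)) ->
  \forall J \near Jo, {for J, continuous h}.
Proof.
move=> V P S F g phi Cc Pc Sc Dc uniq h hE Jo fo _ _.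
suff hc : continuous h.
  by apply: (@filterE _ _ (nbhs_filter Jo)) => J; exact: hc.
apply: (@unique_zero_continuous 'cV[R]_L 'cV[R]_L 'cV[R]_L F 0 phi h).
- by apply: hausdorff_accessible; exact: norm_hausdorff.
- exact: feasible_flows_compact.
- exact: excess_flow_continuous.
- by move=> J; have [] := hE J.
(* Within [F], the zeros of [phi (J, _)] are exactly the equilibria under [J], so uniqueness of the
   equilibrium identifies them with [h J]. *)
move=> J f Ff; split=> [/eqP|->].
  rewrite /phi /excess_flow /= subr_eq0 => /eqP gf.
  have [f' [_ f'u]] := uniq J.
  by rewrite -(f'u _ (conj Ff gf)) (f'u _ (hE J)).
by rewrite /phi /excess_flow /= (proj2 (hE J)) subrr.
Qed.
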